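(* For every $\mu>0$ there exist a nonzero-sum mean-payoff game $\mathcal{G}$ and a strategy $\sigma_0$ of Player 0 in $\mathcal{G}$ such that there exist $\delta>0$, a perturbed game $\mathcal{H}\in\mathcal{G}^{\pm\delta}$, and a vertex $v$ of $\mathcal{G}$ with $$\mathsf{ASV}_{\mathcal{H}}(\sigma_0)(v)<\mathsf{ASV}_{\mathcal{G}}(\sigma_0)(v)-\mu .$$
   Context: An arena $(V,E,\langle V_0,V_1\rangle,w_0,w_1)$ consists of a finite set $V$ of vertices, a set $E\subseteq V\times V$ of edges such that every vertex has at least one successor, a partition of $V$ into $V_0$ (Player 0) and $V_1$ (Player 1), and weight functions $w_0,w_1:E\to\mathbb{Z}$. A (nonzero-sum) mean-payoff game $\mathcal{G}$ is played on such an arena. A play is an infinite path $\pi=\pi_0\pi_1\dots$; a history is a nonempty finite prefix of a play. The payoff of Player $i\in\{0,1\}$ is $\underline{\mathsf{MP}}_i(\pi)=\liminf_{k\to\infty}\frac1k w_i(\pi_0\dots\pi_k)$, where $w_i$ of a history is the sum of the $w_i$-weights of its edges. A strategy of Player $i$ maps each history ending in a vertex of $V_i$ to a successor of that last vertex; $\Sigma_i$ is the set of strategies of Player $i$. $\mathsf{Out}_v(\sigma_0,\sigma_1)$ is the unique play from $v$ consistent with $\sigma_0$ and $\sigma_1$. For $\epsilon>0$, $\mathsf{BR}^{\epsilon}_{1}(\sigma_0)$ is the set of $\sigma_1\in\Sigma_1$ such that for all $v\in V$ and all $\sigma_1'\in\Sigma_1$: $\underline{\mathsf{MP}}_1(\mathsf{Out}_v(\sigma_0,\sigma_1))>\underline{\mathsf{MP}}_1(\mathsf{Out}_v(\sigma_0,\sigma_1'))-\epsilon$.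 The adversarial Stackelberg value of $\sigma_0$ at $v$ is $\mathsf{ASV}(\sigma_0)(v)=\sup_{\epsilon>0}\inf_{\sigma_1\in\mathsf{BR}^{\epsilon}_1(\sigma_0)}\underline{\mathsf{MP}}_0(\mathsf{Out}_v(\sigma_0,\sigma_1))$; a subscript $\mathcal{G}$ or $\mathcal{H}$ indicates the game whose weights are used. For $\delta>0$, $\mathcal{G}^{\pm\delta}$ is the set of games $\mathcal{H}$ with the same $V,E,V_0,V_1$ as $\mathcal{G}$ and with real weight functions $w_0',w_1'$ satisfying $w_i'(e)\in(w_i(e)-\delta,w_i(e)+\delta)$ for all $e\in E$, $i\in\{0,1\}$. Strategies in $\mathcal{G}$ and $\mathcal{H}$ coincide. *)

(* Defs.v *)
From mathcomp Require Import all_boot all_order all_algebra.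
From mathcomp Require Import all_classical all_reals all_analysis.

Set Implicit Arguments.
Unset Strict Implicit.
Unset Printing Implicit Defensive.

Import Order.TTheory GRing.Theory Num.Theory.
Local Open Scope classical_set_scope.
Local Open Scope ring_scope.

Inductive player := P0 | P1.

(* The partition <V_0, V_1> is given by [owner]: V_i is the fibre of i. *)
Record arena := Arena {
  vertex :> finType;
  edge : rel vertex;
  edge_total : forall v, exists u, edge v u;
  owner : vertex -> player }.

(* The pair (w_0, w_1). Only the values at edges matter: plays follow edges. *)
Definition weights (A : arena) (K : Type) := player -> A -> A -> K.

Definition int_weights (R : realType) (A : arena) (w : weights A int) :
  weights A R := fun i u v => (w i u v)%:~R.

(* The nonempty history x :: p is passed as the two arguments x and p; the
   values outside histories of player i are irrelevant. *)
Record strategy (A : arena) (i : player) := Strategy {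
  move :> A -> seq A -> A;
  move_edge : forall x p, path (@edge A) x p -> owner (last x p) = i ->
    edge (last x p) (move x p) }.

Section Outcome.
Variables (A : arena) (s0 : strategy A P0) (s1 : strategy A P1).

Definition next_vertex (x : A) (p : seq A) : A :=
  match owner (last x p) with P0 => s0 x p | P1 => s1 x p end.

Fixpoint Out_hist (v : A) (n : nat) : seq A :=
  if n is m.+1 then rcons (Out_hist v m) (next_vertex v (Out_hist v m))
  else [::].

Definition Out (v : A) : nat -> A := fun n => last v (Out_hist v n).

Definition is_play (pi : nat -> A) := forall n, edge (pi n) (pi n.+1).

Definition consistent (i : player) (s : strategy A i) (pi : nat -> A) :=
  forall n, owner (pi n) = i ->
    pi n.+1 = s (pi 0%N) [seq pi k | k <- iota 1 n].

Lemma Out_histE v n : Out_hist v n = [seq Out v k | k <- iota 1 n].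
Proof.
elim: n => // n IHn.
by rewrite -[n.+1]addn1 iotaD map_cat -IHn /= addn1 cats1 /Out add1n /= last_rcons.
Qed.

Lemma next_vertex_edge x p : path (@edge A) x p ->
  edge (last x p) (next_vertex x p).
Proof.
by move=> xp; rewrite /next_vertex; case o: owner; apply: move_edge.
Qed.

Lemma Out_hist_path v n : path (@edge A) v (Out_hist v n).
Proof.
by elim: n => //= n IHn; rewrite rcons_path IHn /= next_vertex_edge.
Qed.

Lemma Out_unique v pi :
  [/\ pi 0%N = v, is_play pi, consistent s0 pi & consistent s1 pi] <->
  pi = Out v.
Proof.
split=> [[pi0 _ c0 c1]|->].
- have E n : [seq pi k | k <- iota 1 n] = Out_hist v n /\ pi n = Out v n.
    elim: n => [//|n [IH1 IH2]].
    have piS : pi n.+1 = next_vertex v (Out_hist v n).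
      rewrite /next_vertex -/(Out v n) -IH2 -IH1.
      by case o: owner; [rewrite c0 // pi0|rewrite c1 // pi0].
    split; last by rewrite piS /Out /= last_rcons.
    by rewrite -[n.+1]addn1 iotaD map_cat IH1 /= addn1 cats1 add1n piS.
  by apply/funext => n; case: (E n).
- split=> // [n|n o|n o].
  + by rewrite /Out /= last_rcons; apply: next_vertex_edge (Out_hist_path v n).
  + rewrite -Out_histE {1}/Out /= last_rcons /next_vertex.
    by move: o; rewrite /Out => ->.
  + rewrite -Out_histE {1}/Out /= last_rcons /next_vertex.
    by move: o; rewrite /Out => ->.
Qed.

End Outcome.

Section Values.
Variables (R : realType) (A : arena) (w : weights A R).
Local Open Scope ereal_scope.

Definition MP (i : player) (pi : nat -> A) : \bar R :=
  limn_einf (fun k => (k%:R^-1 * \sum_(j < k) w i (pi j) (pi j.+1))%R%:E).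

Definition BR1 (eps : R) (s0 : strategy A P0) : set (strategy A P1) :=
  [set s1 | forall (v : A) (s1' : strategy A P1),
     MP P1 (Out s0 s1 v) > MP P1 (Out s0 s1' v) - eps%:E].

Definition ASV (s0 : strategy A P0) (v : A) : \bar R :=
  ereal_sup [set ereal_inf [set MP P0 (Out s0 s1 v) | s1 in BR1 eps s0]
            | eps in [set eps : R | (0 < eps)%R]].

End Values.

Definition perturbations (R : realType) (A : arena) (w : weights A int)
    (delta : R) : set (weights A R) :=
  [set w' | forall (i : player) (u v : A), edge u v ->
     w' i u v \in `](w i u v)%:~R - delta, (w i u v)%:~R + delta[].

(* Main.v *)
(* Player 1 moves once, to one of two absorbing vertices.  Player 0 gets 0 at
   [Some true] and -m < -mu at [Some false].  In G Player 1 strictly prefers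
   [Some true], by a margin of 1, so 1-best responses give Player 0 the payoff
   0.  In H this preference is erased: every strategy of Player 1 is a best
   response, including those that give -m.  The perturbation
   is bounded by 2 whatever mu is. *)
Require Import Defs.
From mathcomp Require Import all_boot all_order all_algebra.
From mathcomp Require Import all_classical all_reals all_analysis.

Set Implicit Arguments.
Unset Strict Implicit.
Unset Printing Implicit Defensive.

Import Order.TTheory GRing.Theory Num.Theory.
Local Open Scope classical_set_scope.
Local Open Scope ring_scope.

Lemma MP_constant (R : realType) (A : arena) (w : weights A R) (i : player)
    (pi : nat -> A) (c : R) :
  (forall n, w i (pi n) (pi n.+1) = c) -> MP w i pi = c%:E.
Proof.
move=> wc; suff h : (k%:R^-1 * \sum_(j < k) w i (pi j) (pi j.+1))%:E
    @[k --> \oo] --> c%:E by rewrite /MP (cvg_limn_einf_sup h).1.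
(* At [k = 0] the average is [0^-1 * 0 = 0], whatever [c] is, so constancy is claimed from [k = 1]
   on. *)
apply: cvg_near_cst; exists 1%N => // k /= k_gt0.
congr EFin; under eq_bigr do rewrite wc.
by rewrite sumr_const card_ord -[c *+ k]mulr_natl mulKf // pnatr_eq0 -lt0n.
Qed.

Lemma Out_is_play (A : arena) (s0 : strategy A P0) (s1 : strategy A P1) (v : A) :
  is_play (Out s0 s1 v).
Proof. by case: ((Out_unique s0 s1 v _).2 erefl). Qed.

Definition choice_edge (u v : option bool) : bool :=
  if u is Some _ then u == v else v != None.

Lemma choice_edge_total u : exists v, choice_edge u v.
Proof. by case: u => [b|]; [exists (Some b) => /=|exists (Some true)]. Qed.

Definition choice_arena : arena := Arena choice_edge_total (fun=> P1).

Definition choose_move (b : bool) (x : choice_arena) (p : seq choice_arena) :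
  choice_arena := Some (odflt b (last x p)).

Lemma choose_move_edge b x p : path (@edge choice_arena) x p ->
  owner (last x p) = P1 -> edge (last x p) (choose_move b x p).
Proof. by rewrite /choose_move; case: (last x p) => [c|] _ _ /=. Qed.

Definition choose (b : bool) : strategy choice_arena P1 :=
  Strategy (@choose_move_edge b).

(** Vacuous, since Player 0 owns no vertex: staying put at [None] would not even follow an edge. *)
Lemma idle_move_edge (x : choice_arena) p : path (@edge choice_arena) x p ->
  owner (last x p) = P0 -> edge (last x p) (last x p).
Proof. by []. Qed.

Definition idle : strategy choice_arena P0 := Strategy idle_move_edge.

(** Every edge ends in an absorbing vertex, so one step settles the play. Index 0 is excluded
    because [v] may be [None]. *)
Lemma Out_choice_settles s0 s1 (v : choice_arena) :
  exists b, forall n, Out s0 s1 v n.+1 = Some b.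
Proof.
have play := @Out_is_play _ s0 s1 v.
have [b Ob] : exists b, Out s0 s1 v 1 = Some b.
  have := play 0; rewrite /edge /= /choice_edge.
  case: (Out s0 s1 v 1) => [b _|]; first by exists b.
  by case: (Out s0 s1 v 0).
exists b; elim=> // n IHn.
by have := play n.+1; rewrite IHn /edge /= => /eqP <-.
Qed.

Lemma Out_choose s0 b n : Out s0 (choose b) (None : choice_arena) n.+1 = Some b.
Proof.
have [c Oc] := Out_choice_settles s0 (choose b) None.
by rewrite Oc -(Oc 0).
Qed.

(** Weighting an edge by its target gives the initial move the same weight as the loop that follows,
    so weights are constant along each play. *)
Definition target_weights (K : nmodType) (c : player -> bool -> K) :
  weights choice_arena K := fun i _ v => oapp (c i) 0 v.

Theorem proposition2 (R : realType) (mu : R) (hmu : 0 < mu) :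
  exists (A : arena) (wG : weights A int) (s0 : strategy A P0),
  exists (delta : R) (wH : weights A R) (v : A),
    [/\ 0 < delta,
        perturbations wG delta wH &
        (ASV wH s0 v < ASV (int_weights R wG) s0 v - mu%:E)%E].
Proof.
(* The weights of G are integers, so [mu] itself cannot serve as the loss. *)
have [m mu_lt_m] : exists m : nat, mu < m%:R.
  by exists (Num.truncn mu).+1; rewrite truncnS_gt.
pose cG i (b : bool) : int :=
  match i with P0 => if b then 0 else - m%:Z | P1 => b%:Z end.
pose cH i (b : bool) : R :=
  match i with P0 => if b then 0 else - m%:R | P1 => 0 end.
pose wG := target_weights cG; pose wH := target_weights cH.
exists choice_arena, wG, idle, 2, wH, None; split => //.
  have itv_self (x : R) : x \in `]x - 2, x + 2[.
    by rewrite in_itv /= ltrBlDr ltrDl ltr0n.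
  move=> i u [b|] _; last exact: itv_self.
  case: i b => [] [] /=; try exact: itv_self.
    by rewrite /wG /wH /= mulrNz; exact: itv_self.
  (* The only weight that changes: Player 1's 1 at [Some true] becomes 0, within distance 2. *)
  by rewrite /wH /wG /= in_itv /= subr_lt0 ltr1n addr_gt0.
have ASVG : (0 <= ASV (int_weights R wG) idle None)%E.
  apply: le_trans (ereal_sup_ubound _); last by exists 1 => /=.
  apply: le_ereal_inf_tmp => _ [s1 s1_best <-].
  have [[] s1E] := Out_choice_settles idle s1 None.
    by rewrite (@MP_constant _ _ _ _ _ 0) // => n; rewrite /int_weights s1E.
  (* If [s1] settles at [Some false], this deviation raises Player 1's payoff from 0 to 1. The
     strict inequality defining [BR1] would read [0 > 1 - 1], so [eps = 1] already excludes [s1]. *)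
  have := s1_best None (choose true).
  rewrite (@MP_constant _ _ _ _ _ 1); last first.
    by move=> n; rewrite /int_weights Out_choose.
  rewrite (@MP_constant _ _ _ _ _ 0); last first.
    by move=> n; rewrite /int_weights s1E.
  by rewrite -EFinB subrr ltxx.
have ASVH : (ASV wH idle None <= (- m%:R)%:E)%E.
  apply: ge_ereal_sup => _ [eps /= eps_gt0 <-].
  (* The same bad response works for every [eps], so the supremum is bounded as well. *)
  apply: ereal_inf_lbound; exists (choose false); last first.
    by apply: MP_constant => n; rewrite Out_choose.
  have MP0 s1 v : MP wH P1 (Out idle s1 v) = 0%E.
    have [b s1E] := Out_choice_settles idle s1 v.
    by apply: MP_constant => n; rewrite s1E.
  by move=> v s1'; rewrite !MP0 sub0e lteNl oppe0 lte_fin.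
apply: le_lt_trans ASVH _; apply: (@lt_le_trans _ _ (- mu)%:E).
  by rewrite lte_fin ltrN2.
by rewrite EFinN leeDr.
Qed.
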